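(* Let $\mathbf S:\mathbb R^N\to\mathbb R^N$ be continuously differentiable with Jacobian $\nabla\mathbf S(\mathbf z)$ and zero set $\mathcal S=\{\mathbf z:\mathbf S(\mathbf z)=\mathbf 0\}$, let $V(\mathbf z)=\tfrac12\|\mathbf S(\mathbf z)\|^2$, and let $\mathcal U\subseteq\mathbb R^N$ be an open set with $\mathcal S\subseteq\mathcal U$ such that $\nabla\mathbf S(\mathbf z)$ is invertible for every $\mathbf z\in\mathcal U$. Let $\sigma(V,t)$ be any of the decay laws (Exp), (FT), (FxT), (PT) listed in the context, and set $\lambda(V,t)=\sigma(V,t)/(2V)$. Then for every $\mathbf z\in\mathcal U$ with $V(\mathbf z)\ne0$ and every admissible $t$, the feedback $$\mathbf u(\mathbf z,t)=-\lambda(V(\mathbf z),t)\,\nabla\mathbf S(\mathbf z)^{-1}\mathbf S(\mathbf z)$$ for the system $\dot{\mathbf z}=\mathbf u$ satisfies $$\dot V(\mathbf z,t)=\nabla V(\mathbf z)^\top\mathbf u(\mathbf z,t)=-\sigma(V(\mathbf z),t).$$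
   Context: $\nabla\mathbf S(\mathbf z)$ denotes the Jacobian matrix $\partial\mathbf S/\partial\mathbf z$, so $\nabla V(\mathbf z)=\nabla\mathbf S(\mathbf z)^\top\mathbf S(\mathbf z)$. For $\dot{\mathbf z}=\mathbf u(\mathbf z,t)$ one writes $\dot V(\mathbf z,t)=\nabla V(\mathbf z)^\top\mathbf u(\mathbf z,t)$. Decay laws: $\sigma(V,t)$ is one of (Exp) $c\,V$; (FT) $k\,V^{\gamma}$ with $0<\gamma<1$; (FxT) $a\,V^{\gamma}+b\,V^{\delta}$ with $0<\gamma<1<\delta$; (PT) $\frac{\mu}{T-t}V$ for $t\in[0,T)$; where $a,b,c,k,\mu,T$ are positive constants. Admissible times are $t\ge0$ in the first three cases and $t\in[0,T)$ in the (PT) case. *)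

(* Defs.v *)
From mathcomp Require Import all_boot all_order all_algebra.
From mathcomp Require Import all_classical all_reals all_analysis.
Set Implicit Arguments.
Unset Strict Implicit.
Unset Printing Implicit Defensive.
Import Order.TTheory GRing.Theory Num.Theory.
Import numFieldNormedType.Exports.
Local Open Scope classical_set_scope.
Local Open Scope ring_scope.

(* Points of R^N are column vectors 'cV[R]_N.  The library norm `|x| on
   matrices is the sup norm, so the Euclidean norm is introduced here; the
   topology is the same. *)
Definition enorm (R : realType) (N : nat) (x : 'cV[R]_N) : R :=
  Num.sqrt (\sum_(i < N) x i 0 ^+ 2).

Definition partial (R : realType) (N : nat) (f : 'cV[R]_N -> R) (j : 'I_N)
    (z : 'cV[R]_N) : R :=
  'D_(delta_mx j 0) f z.

Definition grad (R : realType) (N : nat) (f : 'cV[R]_N -> R)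
    (z : 'cV[R]_N) : 'cV[R]_N :=
  \col_j partial f j z.

(* Usual convention: row i, column j holds dS_i/dz_j.  The library's [jacobian]
   is the transpose of this and is restricted to row vectors. *)
Definition Jac (R : realType) (N : nat) (S : 'cV[R]_N -> 'cV[R]_N)
    (z : 'cV[R]_N) : 'M[R]_N :=
  \matrix_(i, j) partial (fun x => S x i 0) j z.

Definition continuously_differentiable (R : realType) (N : nat)
    (S : 'cV[R]_N -> 'cV[R]_N) : Prop :=
  (forall z, differentiable S z) /\ continuous (Jac S).

Definition zero_set (R : realType) (N : nat) (S : 'cV[R]_N -> 'cV[R]_N) :
    set 'cV[R]_N :=
  [set z | S z = 0].

Definition lyapunov (R : realType) (N : nat) (S : 'cV[R]_N -> 'cV[R]_N)
    (z : 'cV[R]_N) : R :=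
  2^-1 * enorm (S z) ^+ 2.

Inductive decay_law (R : realType) : Type :=
  | Exp (c : R)
  | FT (k gamma : R)
  | FxT (a gamma b delta : R)
  | PT (mu T : R).

Definition decay_law_valid (R : realType) (l : decay_law R) : Prop :=
  match l with
  | Exp c => 0 < c
  | FT k gamma => 0 < k /\ 0 < gamma < 1
  | FxT a gamma b delta => [/\ 0 < a, 0 < b, 0 < gamma < 1 & 1 < delta]
  | PT mu T => 0 < mu /\ 0 < T
  end.

Definition admissible_time (R : realType) (l : decay_law R) (t : R) : Prop :=
  match l with
  | PT _ T => 0 <= t < T
  | _ => 0 <= t
  end.

Definition sigma (R : realType) (l : decay_law R) (V t : R) : R :=
  match l with
  | Exp c => c * V
  | FT k gamma => k * V `^ gamma
  | FxT a gamma b delta => a * V `^ gamma + b * V `^ delta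
  | PT mu T => mu / (T - t) * V
  end.

Definition lambda (R : realType) (l : decay_law R) (V t : R) : R :=
  sigma l V t / (2 * V).

Definition feedback (R : realType) (N : nat) (S : 'cV[R]_N -> 'cV[R]_N)
    (l : decay_law R) (z : 'cV[R]_N) (t : R) : 'cV[R]_N :=
  - lambda l (lyapunov S z) t *: (invmx (Jac S z) *m S z).

(* Derivative of V along the system z' = u(z, t). *)
Definition orbital_derivative (R : realType) (N : nat) (V : 'cV[R]_N -> R)
    (u : 'cV[R]_N -> R -> 'cV[R]_N) (z : 'cV[R]_N) (t : R) : R :=
  ((grad V z)^T *m u z t) 0 0.

(* Main.v *)
Require Import Defs.
From mathcomp Require Import all_boot all_order all_algebra.
From mathcomp Require Import all_classical all_reals all_analysis.
Import Order.TTheory GRing.Theory Num.Theory.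
Import numFieldNormedType.Exports.
Local Open Scope classical_set_scope.
Local Open Scope ring_scope.

(** Since V = (S^T S)/2, the chain rule gives grad V = J^T S.  With
    u = - lambda J^-1 S the Jacobian cancels, leaving
    V' = - lambda S^T S = - 2 lambda V = - sigma. *)

(** The analysis is confined to [grad_lyapunov]; with [trmx_mul_self] the rest is matrix algebra,
    and the four decay laws are treated uniformly through the ratio [lambda]. *)

Lemma lyapunovE (R : realType) (N : nat) (S : 'cV[R]_N -> 'cV[R]_N)
    (z : 'cV[R]_N) :
  lyapunov S z = 2^-1 * \sum_(i < N) S z i 0 ^+ 2.
Proof.
by rewrite /lyapunov /enorm sqr_sqrtr// sumr_ge0// => i _; exact: sqr_ge0.
Qed.

Lemma trmx_mul_self (R : realType) (N : nat) (S : 'cV[R]_N -> 'cV[R]_N)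
    (z : 'cV[R]_N) :
  (S z)^T *m S z = (2 * lyapunov S z)%:M.
Proof.
apply/matrixP => i j; rewrite !ord1 !mxE eqxx mulr1n lyapunovE.
rewrite mulVKf ?pnatr_eq0//.
by apply: eq_bigr => k _; rewrite mxE expr2.
Qed.

(** Componentwise, dV/dz_j = sum_i S_i dS_i/dz_j, the 2 from each square cancelling the factor
    1/2. *)
Lemma grad_lyapunov (R : realType) (N : nat) (S : 'cV[R]_N -> 'cV[R]_N)
    (z : 'cV[R]_N) :
  differentiable S z -> grad (lyapunov S) z = (Jac S z)^T *m S z.
Proof.
move=> dS; apply/colP => j; rewrite !mxE /partial.
set v := delta_mx j 0.
have dSi i : is_derive z v (fun x => S x i 0) ('D_v (fun x => S x i 0) z).
  (* Differentiability of [S] gives a derivative along [v], hence one for each entry. *)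
  apply: derivableP; move: i 0; apply/derivable_mxP; exact: diff_derivable.
(* Written without the square root and as an algebraic combination of functions, V matches the
   differentiation rules for scalings, sums and powers. *)
have -> : lyapunov S = 2^-1 \*: \sum_(i < N) (fun x => S x i 0) ^+ 2.
  by apply/funext => x; rewrite lyapunovE /= fct_sumE.
have dV := is_deriveZ 2^-1 (is_derive_sum (fun i => is_deriveX 2 (dSi i))).
rewrite (derive_val (is_derive := dV)) scaler_sumr.
apply: eq_bigr => i _; rewrite !mxE /partial expr1 scalerA mulrA.
by rewrite mulVf ?pnatr_eq0// mul1r mulrC.
Qed.

Theorem mainTheorem2 (R : realType) (N : nat) (S : 'cV[R]_N -> 'cV[R]_N)
    (U : set 'cV[R]_N) (l : decay_law R)
    (S_C1 : continuously_differentiable S)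
    (U_open : open U)
    (zero_set_U : zero_set S `<=` U)
    (Jac_inv : forall z : 'cV[R]_N, U z -> Jac S z \in unitmx)
    (l_valid : decay_law_valid l)
    (z : 'cV[R]_N) (Uz : U z) (Vz_neq0 : lyapunov S z <> 0)
    (t : R) (t_adm : admissible_time l t) :
  orbital_derivative (lyapunov S) (feedback S l) z t =
    - sigma l (lyapunov S z) t.
Proof.
have [dS _] := S_C1.
rewrite /orbital_derivative /feedback grad_lyapunov// trmx_mul trmxK.
(* The row S^T J now meets J^-1 S, and J J^-1 cancels since [z] lies in [U]. *)
rewrite -scalemxAr -mulmxA mulKVmx ?Jac_inv// trmx_mul_self.
rewrite !mxE eqxx mulr1n mulNr /lambda divfK//.
(* Cancelling 2V against the denominator of [lambda] requires V to be nonzero at [z]. *)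
by rewrite mulf_neq0 ?pnatr_eq0//; exact/eqP.
Qed.
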